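(* Let $d\ge 2$ and suppose that $\mathcal{X}^n=\{X_1,X_2,\dots,X_n\}\subset\mathbb{R}^d$ is of affine dimension $d$. Let $\lambda^*=\sup_{x\in\mathbb{R}^d}D(x,F_n)$ be the maximal halfspace depth. Then for every $\tau\in(0,\lambda^*]$, $$\mathcal{D}_\tau(\mathcal{X}^n)=\bigcap_{i=1}^{m_\tau}\mathcal{H}_\tau(\mu_i),$$ where $\mathcal{H}_\tau(\mu_1),\dots,\mathcal{H}_\tau(\mu_{m_\tau})$ are all the $\tau$-irrotatable halfspaces and $m_\tau$ denotes their number.
   Context: The sample $\mathcal{X}^n$ is a finite multiset of points (repetitions allowed, not necessarily in general position); it is of affine dimension $d$ if its affine hull is $\mathbb{R}^d$. Let $\mathcal{S}^{d-1}$ be the Euclidean unit sphere of $\mathbb{R}^d$, and $F_n$, $P_n$ the empirical distribution and empirical probability measure of $\mathcal{X}^n$. Halfspace depth: $D(x,F_n)=\inf_{u\in\mathcal{S}^{d-1}}P_n(u^\top X\le u^\top x)$. Depth regions: $\mathcal{D}_\tau(\mathcal{X}^n)=\{x\in\mathbb{R}^d:D(x,F_n)\ge\tau\}$. (The paper defines $\lambda^*$ as the depth $D(\hat\theta_n,F_n)$ of Tukey's halfspace median $\hat\theta_n$, the average of all points of maximal depth; this is the maximal depth.) For $u\in\mathcal{S}^{d-1}$ and $\tau\in(0,1)$, the $(\tau,u)$-halfspace is $\mathcal{H}_\tau(u)=\{x\in\mathbb{R}^d:u^\top x\ge q_\tau(u)\}$, with complement $\mathcal{H}_\tau^c(u)=\{x:u^\top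 x<q_\tau(u)\}$ and boundary $\partial\mathcal{H}_\tau(u)=\{x:u^\top x=q_\tau(u)\}$, where $q_\tau(u)=\inf\{t\in\mathbb{R}:F_{un}(t)\ge\tau\}$ and $F_{un}$ is the empirical distribution function of $\{u^\top X_1,\dots,u^\top X_n\}$. A halfspace ''cuts away'' the sample points lying in its complement; all sample points are counted with multiplicity. A halfspace $\mathcal{H}_\tau(u)$ is called $\tau$-irrotatable if: (a) $nP_n(X\in\mathcal{H}_\tau^c(u))\le\lceil n\tau\rceil-1$, i.e. $\mathcal{H}_\tau(u)$ cuts away at most $\lceil n\tau\rceil-1$ sample points; (b) $\partial\mathcal{H}_\tau(u)$ contains at least $d$ sample points, and among them there exist $d-1$ points which determine a $(d-2)$-dimensional affine subspace $V$ (a single point if $d=2$) such that $\mathcal{H}_\tau(u)$ can be made to cut away more than $\lceil n\tau\rceil-1$ sample points merely by deviating (rotating) it around $V$ by an arbitrarily small amount. That is: for every $\delta>0$ there is $u'\in\mathcal{S}^{d-1}$ with $\|u'-u\|<\delta$ such that $u'^\top x$ takes a constant value $c$ for $x\in V$, and the halfspace $\{x:u'^\top x\ge c\}$ cuts away more than $\lceil n\tau\rceil-1$ sample points. *)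

(* Defs.v *)
From mathcomp Require Import all_boot all_order all_algebra.
From mathcomp Require Import mathcomp_extra boolp classical_sets reals.

Set Implicit Arguments.
Unset Strict Implicit.
Unset Printing Implicit Defensive.

Import Order.TTheory GRing.Theory Num.Theory.

Local Open Scope classical_set_scope.
Local Open Scope ring_scope.

(* Points of R^d are column vectors; the
   norm that MathComp-Analysis puts on matrices is the sup norm, hence the
   explicit Euclidean norm here. *)
Definition dotv (R : realType) (d : nat) (u x : 'cV[R]_d) : R :=
  (u^T *m x) 0 0.

Definition enorm (R : realType) (d : nat) (x : 'cV[R]_d) : R :=
  Num.sqrt (dotv x x).

Definition usphere (R : realType) (d : nat) : set 'cV[R]_d :=
  [set u | enorm u = 1].

Definition affine_hull (R : realType) (d m : nat) (p : 'I_m -> 'cV[R]_d) :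
    set 'cV[R]_d :=
  [set x | exists c : 'I_m -> R,
     \sum_(i < m) c i = 1 /\ x = \sum_(i < m) c i *: p i].

(* Dimension of the direction space of [affine_hull p], which is spanned by the
   differences of the points p i. It is the affine dimension for m > 0; the
   empty family also gets 0. *)
Definition affine_dim (R : realType) (d m : nat) (p : 'I_m -> 'cV[R]_d) : nat :=
  \dim <<[seq p i - p j | i <- enum 'I_m, j <- enum 'I_m]>>%VS.

(* A sample is an indexed family, so that repeated points are allowed and every
   count is taken with multiplicity. *)
Definition sample_count (R : realType) (d n : nat) (X : 'I_n -> 'cV[R]_d)
    (A : set 'cV[R]_d) : nat :=
  #|[pred i | X i \in A]|.

Definition empirical (R : realType) (d n : nat) (X : 'I_n -> 'cV[R]_d)
    (A : set 'cV[R]_d) : R :=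
  (sample_count X A)%:R / n%:R.

Definition depth (R : realType) (d n : nat) (X : 'I_n -> 'cV[R]_d)
    (x : 'cV[R]_d) : R :=
  inf [set empirical X [set y | dotv u y <= dotv u x] | u in @usphere R d].

Definition depth_region (R : realType) (d n : nat) (X : 'I_n -> 'cV[R]_d)
    (tau : R) : set 'cV[R]_d :=
  [set x | tau <= depth X x].

Definition proj_cdf (R : realType) (d n : nat) (X : 'I_n -> 'cV[R]_d)
    (u : 'cV[R]_d) (t : R) : R :=
  empirical X [set y | dotv u y <= t].

Definition quantile (R : realType) (d n : nat) (X : 'I_n -> 'cV[R]_d)
    (tau : R) (u : 'cV[R]_d) : R :=
  inf [set t | tau <= proj_cdf X u t].

Definition halfspace (R : realType) (d n : nat) (X : 'I_n -> 'cV[R]_d)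
    (tau : R) (u : 'cV[R]_d) : set 'cV[R]_d :=
  [set x | dotv u x >= quantile X tau u].

Definition halfspace_bd (R : realType) (d n : nat) (X : 'I_n -> 'cV[R]_d)
    (tau : R) (u : 'cV[R]_d) : set 'cV[R]_d :=
  [set x | dotv u x = quantile X tau u].

(* The family p lists the d - 1 sample points that determine V. *)
Definition irrotatable (R : realType) (d n : nat) (X : 'I_n -> 'cV[R]_d)
    (tau : R) (u : 'cV[R]_d) : Prop :=
  let k : int := Num.ceil (n%:R * tau) - 1 in
  [/\ usphere u,
      (sample_count X (~` halfspace X tau u))%:Z <= k,
      (d <= sample_count X (halfspace_bd X tau u))%N &
      exists s : 'I_d.-1 -> 'I_n,
        let p := X \o s in
        [/\ forall j, halfspace_bd X tau u (p j),
            affine_dim p = d.-2 &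
            forall delta : R, 0 < delta ->
              exists (u' : 'cV[R]_d) (c : R),
                [/\ usphere u', enorm (u' - u) < delta,
                    forall x, affine_hull p x -> dotv u' x = c &
                    k < (sample_count X (~` [set x | dotv u' x >= c]))%:Z]]].

(* Main.v *)
Require Import Defs.
From mathcomp Require Import all_boot all_order all_algebra.
From mathcomp Require Import mathcomp_extra boolp classical_sets reals.
From mathcomp Require Import cardinality ring lra.

(** A point of level less than tau lies off some (tau, u)-halfspace.  Fix y0 in
    the depth region and x0 off it.  Among all hyperplanes u^T x = c that cut
    away fewer than n tau sample points, normalised by u^T (y0 - x0) = 1, maximise
    c - u^T x0.  This objective is bounded by 1 because of y0, and the feasible
    set is a union of cells of the arrangement of the hyperplanes u^T X_i = c, so
    the maximum is attained at a vertex: the sample points on the optimal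
    hyperplane, lifted to (X_i, -1), form together with (y0 - x0, 0) a spanning
    family.  In the basis dual to d of these points and (y0 - x0, 0), some
    vector changes the objective, since (-x0, 1) is not a multiple of
    (y0 - x0, 0).  It is a rotation around the affine hull V of the other d - 1
    points, and moving in the increasing direction violates feasibility by
    maximality, however small the step: the halfspace is irrotatable and
    excludes x0. *)

Set Implicit Arguments.
Unset Strict Implicit.
Unset Printing Implicit Defensive.

Import Order.TTheory GRing.Theory Num.Theory.

Local Open Scope classical_set_scope.
Local Open Scope ring_scope.

(** * Dot product and Euclidean norm *)

Section DotProduct.
Variables (R : realType) (d : nat).
Implicit Types u v x y : 'cV[R]_d.

Lemma dotvE u x : dotv u x = \sum_k u k 0 * x k 0.
Proof. by rewrite /dotv mxE; apply: eq_bigr => k _; rewrite mxE. Qed.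

Lemma dotvC u x : dotv u x = dotv x u.
Proof. by rewrite !dotvE; apply: eq_bigr => k _; rewrite mulrC. Qed.

Lemma dotvDl u v x : dotv (u + v) x = dotv u x + dotv v x.
Proof. by rewrite /dotv linearD mulmxDl mxE. Qed.

Lemma dotvZl (c : R) u x : dotv (c *: u) x = c * dotv u x.
Proof. by rewrite /dotv linearZ -scalemxAl mxE. Qed.

Lemma dotvNl u x : dotv (- u) x = - dotv u x.
Proof. by rewrite -scaleN1r dotvZl mulN1r. Qed.

Lemma dotvBl u v x : dotv (u - v) x = dotv u x - dotv v x.
Proof. by rewrite dotvDl dotvNl. Qed.

Lemma dotvDr u x y : dotv u (x + y) = dotv u x + dotv u y.
Proof. by rewrite dotvC dotvDl !(dotvC u). Qed.

Lemma dotvZr (c : R) u x : dotv u (c *: x) = c * dotv u x.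
Proof. by rewrite dotvC dotvZl dotvC. Qed.

Lemma dotvNr u x : dotv u (- x) = - dotv u x.
Proof. by rewrite dotvC dotvNl dotvC. Qed.

Lemma dotvBr u x y : dotv u (x - y) = dotv u x - dotv u y.
Proof. by rewrite dotvDr dotvNr. Qed.

Lemma dotv0l x : dotv 0 x = 0.
Proof. by rewrite -(scale0r x) dotvZl mul0r. Qed.

Lemma dotv0r x : dotv x 0 = 0.
Proof. by rewrite dotvC dotv0l. Qed.

Lemma dotv_sumr u (I : finType) (F : I -> 'cV[R]_d) :
  dotv u (\sum_i F i) = \sum_i dotv u (F i).
Proof. exact: (big_morph (dotv u) (dotvDr u) (dotv0r u)). Qed.

Lemma dotv_ge0 u : 0 <= dotv u u.
Proof. by rewrite dotvE sumr_ge0 // => k _; rewrite -expr2 sqr_ge0. Qed.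

Lemma dotv_eq0 u : (dotv u u == 0) = (u == 0).
Proof.
apply/eqP/eqP => [|->]; last exact: dotv0l.
rewrite dotvE => /psumr_eq0P u0; apply/colP => k; rewrite mxE.
by apply/eqP; rewrite -sqrf_eq0 expr2 u0 // => i _; rewrite -expr2 sqr_ge0.
Qed.

Lemma usphereE u : usphere u <-> dotv u u = 1.
Proof.
rewrite /usphere /= /enorm; split=> [u1|->]; last exact: sqrtr1.
by rewrite -(sqr_sqrtr (dotv_ge0 u)) u1 expr1n.
Qed.

Lemma enorm_gt0 u : u != 0 -> 0 < enorm u.
Proof. by move=> u0; rewrite sqrtr_gt0 lt0r dotv_eq0 u0 dotv_ge0. Qed.

Lemma usphere_normalize u : u != 0 -> usphere ((enorm u)^-1 *: u).
Proof.
move=> u0; apply/usphereE; rewrite dotvZl dotvZr mulrA -expr2 exprVn.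
by rewrite sqr_sqrtr ?dotv_ge0 // mulVf // dotv_eq0.
Qed.

(** Every coordinate of [u] is at most [enorm u] in absolute value, so this crude bound needs no
    Cauchy-Schwarz inequality. *)
Lemma dotv_norm_le u x : `|dotv u x| <= enorm u * \sum_k `|x k 0|.
Proof.
rewrite dotvE mulr_sumr (le_trans (ler_norm_sum _ _ _)) // ler_sum // => k _.
rewrite normrM ler_wpM2r // -sqrtr_sqr ler_wsqrtr // dotvE (bigD1 k) //= -expr2.
by rewrite lerDl sumr_ge0 // => i _; rewrite -expr2 sqr_ge0.
Qed.

End DotProduct.

(** * Optimal vertices of a union of cells of an arrangement *)

Section Arrangement.
Variables (R : realType) (N n : nat) (a : 'I_n -> 'cV[R]_N).
Implicit Types z w : 'cV[R]_N.

Definition neg_set z : {set 'I_n} := [set i | dotv z (a i) < 0].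
Definition zero_set z : {set 'I_n} := [set i | dotv z (a i) == 0].

Lemma neg_setZ (c : R) z : 0 < c -> neg_set (c *: z) = neg_set z.
Proof. by move=> c0; apply/setP => i; rewrite !inE dotvZl pmulr_rlt0. Qed.

Lemma zero_setZ (c : R) z : c != 0 -> zero_set (c *: z) = zero_set z.
Proof.
by move=> c0; apply/setP => i; rewrite !inE dotvZl mulf_eq0 (negPf c0).
Qed.

(** The step [t] stops no later than the first sign change along [w], and forms vanishing at [z]
    stay zero, so no further form becomes negative. *)
Lemma neg_set_along z w (t : R) : 0 <= t ->
    (forall i, i \in zero_set z -> dotv w (a i) = 0) ->
    (forall i, dotv z (a i) * dotv w (a i) < 0 ->
       t <= - dotv z (a i) / dotv w (a i)) ->
  neg_set (z + t *: w) \subset neg_set z.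
Proof.
move=> t0 zw tle; apply/fintype.subsetP => i; rewrite !inE dotvDl dotvZl => sneg.
have := zw i; rewrite inE.
have [//|zpos _|z0 /(_ isT) w0] := ltgtP (dotv z (a i)) 0.
  have wneg : dotv w (a i) < 0.
    by rewrite ltNge; apply/negP => w0; have := mulr_ge0 t0 w0; lra.
  have := tle i; rewrite pmulr_rlt0 // => /(_ wneg).
  by rewrite ler_ndivlMr //; lra.
by move: sneg; rewrite z0 w0 mulr0 addr0 ltxx.
Qed.

(** Walk along [w] exactly to the first sign change: the form that would change sign vanishes there
    and joins the zero set. *)
Lemma ratio_test z w :
    (forall i, i \in zero_set z -> dotv w (a i) = 0) ->
    (exists i, dotv z (a i) * dotv w (a i) < 0) ->
  exists2 t : R, 0 <= t & neg_set (z + t *: w) \subset neg_set z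
    /\ zero_set z \proper zero_set (z + t *: w).
Proof.
move=> zw [i0 opp0].
pose ratio i := - dotv z (a i) / dotv w (a i).
case: (@arg_minP _ _ _ i0 (fun i => dotv z (a i) * dotv w (a i) < 0) ratio) => //.
move=> i oppi mini.
have wi0 : dotv w (a i) != 0.
  by apply: contraTneq oppi => ->; rewrite mulr0 ltxx.
have zi0 : dotv z (a i) != 0.
  by apply: contraTneq oppi => ->; rewrite mul0r ltxx.
have ratio_ge0 : 0 <= ratio i.
  rewrite /ratio mulNr oppr_ge0.
  have -> : dotv z (a i) / dotv w (a i)
          = (dotv z (a i) * dotv w (a i)) / (dotv w (a i)) ^+ 2.
    by rewrite expr2 invfM mulrA mulfK.
  by rewrite mulr_le0_ge0 ?invr_ge0 ?sqr_ge0 // ltW.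
exists (ratio i) => //; split; first exact: neg_set_along.
apply/properP; split.
  apply/fintype.subsetP => k zk; rewrite inE dotvDl dotvZl zw // mulr0 addr0.
  by move: zk; rewrite inE.
exists i; last by rewrite inE.
by rewrite inE dotvDl dotvZl /ratio divfK // subrr.
Qed.

Variables (P : pred {set 'I_n}) (b o : 'cV[R]_N) (M : R).
Hypothesis P_down : forall A B : {set 'I_n}, A \subset B -> P B -> P A.
Hypothesis a_span : forall w, (forall i, dotv w (a i) = 0) -> w = 0.
Hypothesis o_le : forall z, P (neg_set z) -> dotv z b = 1 -> dotv z o <= M.

(** The last condition says that [b] and the vectors [a i] orthogonal to [z] span the whole
    space. *)
Definition vertex z := [/\ P (neg_set z), dotv z b = 1 &
  forall w, (forall i, i \in zero_set z -> dotv w (a i) = 0) ->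
    dotv w b = 0 -> w = 0].

(** With no sign change ahead, the whole ray from [z] along [w] stays feasible; a positive slope
    would carry the objective past its bound [M]. *)
Lemma direction_le0 z w : P (neg_set z) -> dotv z b = 1 -> dotv w b = 0 ->
    (forall i, i \in zero_set z -> dotv w (a i) = 0) ->
    (forall i, 0 <= dotv z (a i) * dotv w (a i)) ->
  dotv w o <= 0.
Proof.
move=> Pz zb wb zw nopp; rewrite leNgt; apply/negP => wo.
(* This step raises the objective by [|M - dotv z o| + 1], hence beyond [M]. *)
pose t : R := (`|M - dotv z o| + 1) / dotv w o.
have t0 : 0 <= t by rewrite divr_ge0 ?addr_ge0 // ltW.
have := @o_le (z + t *: w); rewrite !dotvDl !dotvZl wb mulr0 addr0.
have Pt : P (neg_set (z + t *: w)).
  apply: P_down Pz; apply: neg_set_along => // i /lt_geF.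
  by rewrite nopp.
move=> /(_ Pt zb); rewrite /t divfK ?gt_eqF //.
by have := ler_norm (M - dotv z o); lra.
Qed.

(** Since [z] is no vertex, some nonzero direction preserves its zeros and the normalisation. Orient
    it so that the objective does not drop and walk to the first sign change. If there is none, the
    objective is constant along it, and the opposite direction serves. *)
Lemma vertex_improve z : P (neg_set z) -> dotv z b = 1 -> ~ vertex z ->
  exists z', [/\ P (neg_set z'), dotv z' b = 1, dotv z o <= dotv z' o
    & zero_set z \proper zero_set z'].
Proof.
move=> Pz zb nvz.
have [w [zw wb w0]] : exists w,
    [/\ forall i, i \in zero_set z -> dotv w (a i) = 0, dotv w b = 0 & w != 0].
  apply: contrapT => nw; apply: nvz; split => // w zw wb; apply/eqP.
  by apply/negPn/negP => w0; apply: nw; exists w.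
have move_along v : (forall i, i \in zero_set z -> dotv v (a i) = 0) ->
    dotv v b = 0 -> 0 <= dotv v o ->
    (exists i, dotv z (a i) * dotv v (a i) < 0) ->
  exists z', [/\ P (neg_set z'), dotv z' b = 1, dotv z o <= dotv z' o
    & zero_set z \proper zero_set z'].
  move=> zv vb vo /(ratio_test zv) [t t0 [negs zeros]].
  exists (z + t *: v); split => //; first exact: P_down Pz.
    by rewrite dotvDl dotvZl vb mulr0 addr0.
  by rewrite dotvDl dotvZl lerDl mulr_ge0.
wlog wo : w zw wb w0 / 0 <= dotv w o => [wlog_w|].
  have [/wlog_w|/ltW wo] := leP 0 (dotv w o); first exact.
  apply: (wlog_w (- w)); rewrite ?dotvNl ?wb ?oppr0 ?oppr_eq0 ?oppr_ge0 //.
  by move=> i /zw; rewrite dotvNl => ->; rewrite oppr0.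
have [/move_along|nopp] := pselect (exists i, dotv z (a i) * dotv w (a i) < 0).
  exact.
have {}nopp i : 0 <= dotv z (a i) * dotv w (a i).
  by rewrite leNgt; apply/negP => ?; apply: nopp; exists i.
have wo0 : dotv w o = 0.
  by apply/eqP; rewrite eq_le wo (direction_le0 Pz).
apply: (move_along (- w)); rewrite ?dotvNl ?wb ?wo0 ?oppr0 //.
  by move=> i /zw; rewrite dotvNl => ->; rewrite oppr0.
(* If neither [w] nor [- w] meets a sign change, every form vanishes on [w], against the spanning
   hypothesis. *)
apply: contrapT => nopp'; move/eqP: w0; apply; apply: a_span => i.
have [zi|zi] := eqVneq (dotv z (a i)) 0; first by apply: zw; rewrite inE zi.
apply/eqP; rewrite -(mulrI_eq0 _ (mulfI zi)) eq_le nopp andbT leNgt.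
by apply/negP => ?; apply: nopp'; exists i; rewrite dotvNl mulrN oppr_lt0.
Qed.

Lemma vertex_above z : P (neg_set z) -> dotv z b = 1 ->
  exists2 z', vertex z' & dotv z o <= dotv z' o.
Proof.
(* Induction on the number of forms not vanishing at [z], which each improvement lowers. *)
have [k] := ubnP (#|~: zero_set z|); elim: k z => // k IHk z zk Pz zb.
have [vz|/(vertex_improve Pz zb) [z' [Pz' zb' oz zz']]] := pselect (vertex z).
  by exists z.
have [|v vv ov] := IHk z' _ Pz' zb'; last by exists v; rewrite // (le_trans oz).
by rewrite -ltnS (leq_ltn_trans _ zk) // proper_card // properC.
Qed.

Lemma vertex_inj z1 z2 : vertex z1 -> vertex z2 ->
  zero_set z1 = zero_set z2 -> z1 = z2.
Proof.
move=> [_ z1b vz1] [_ z2b _] z12; apply/eqP; rewrite -subr_eq0; apply/eqP.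
apply: vz1 => [i zi|]; last by rewrite dotvBl z1b z2b subrr.
have := zi; rewrite z12 => zi2.
by move: zi zi2; rewrite !inE dotvBl => /eqP -> /eqP ->; rewrite subrr.
Qed.

(** A vertex is determined by its zero set, so there are finitely many; the best of them dominates
    every feasible point because each such point has a vertex at least as good. *)
Lemma optimal_vertex z0 : P (neg_set z0) -> dotv z0 b = 1 ->
  exists2 z, vertex z &
    forall y, P (neg_set y) -> dotv y b = 1 -> dotv y o <= dotv z o.
Proof.
move=> Pz0 z0b; have [z1 vz1 _] := vertex_above Pz0 z0b.
pose at_zeros B := [set z | vertex z /\ zero_set z = B].
pose f B := xget 0 (at_zeros B).
have fK z : vertex z -> f (zero_set z) = z.
  move=> vz; apply: xget_unique => // y [vy yz]; exact: vertex_inj.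
pose realized B := `[< exists z, at_zeros B z >].
have realizedP z : vertex z -> realized (zero_set z).
  by move=> vz; apply/asboolP; exists z.
case: (arg_maxP (fun B => dotv (f B) o) (realizedP _ vz1)) => B.
move=> /asboolP [z [vz <-]] maxB; exists z => // y Py yb.
have [v vv oy] := vertex_above Py yb.
by apply: le_trans oy _; have := maxB _ (realizedP _ vv); rewrite !fK.
Qed.

End Arrangement.

(** * Dual basis at a vertex *)

Lemma row_free_rowsub (F : fieldType) (m n r : nat) (A : 'M[F]_(m, n)) :
  \rank A = r -> exists2 f : 'I_r -> 'I_m,
    row_free (rowsub f A) & (rowsub f A :=: A)%MS.
Proof.
move=> <-; exists (maxrankfun A); first exact: maxrowsub_free.
exact: eq_maxrowsub.
Qed.

(** The vectors vanishing at [z] have rank exactly [d]: at most [d] because [z] is a nonzero common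
    annihilator, at least [d] because adding [b] gives full rank. A maximal free subfamily together
    with [b] forms an invertible matrix, and the columns of its inverse are the dual basis. *)
Lemma dual_basis (R : realType) (d n : nat) (a : 'I_n -> 'cV[R]_(d + 1))
    (b z : 'cV[R]_(d + 1)) :
    dotv z b = 1 ->
    (forall w, (forall i, i \in zero_set a z -> dotv w (a i) = 0) ->
       dotv w b = 0 -> w = 0) ->
  exists (f : 'I_d -> 'I_n) (W : 'I_d -> 'cV[R]_(d + 1)),
    [/\ forall i, f i \in zero_set a z,
        forall i k, dotv (W i) (a (f k)) = (i == k)%:R,
        forall i, dotv (W i) b = 0 &
        forall o, (forall i, dotv (W i) o = 0) -> exists c : R, o = c *: b].
Proof.
move=> zb zw.
(* Rows outside the zero set are replaced by zero, so that the index type stays ['I_n]. *)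
pose A : 'M[R]_(n, d + 1) :=
  \matrix_(i, k) if i \in zero_set a z then a i k 0 else 0.
have AE (v : 'cV[R]_(d + 1)) i :
    (A *m v) i 0 = if i \in zero_set a z then dotv (a i) v else 0.
  rewrite mxE; under eq_bigr do rewrite mxE.
  case: ifP => _; first by rewrite dotvE.
  by rewrite big1 // => k _; rewrite mul0r.
have rank_full : \rank (col_mx A b^T) = (d + 1)%N.
  rewrite -mxrank_tr; apply/eqP; apply: inj_row_free => v v0.
  apply: (can_inj (@trmxK _ _ _)); rewrite trmx0.
  have {}v0 : col_mx A b^T *m v^T = 0.
    by apply: (can_inj (@trmxK _ _ _)); rewrite trmx_mul trmxK v0 trmx0.
  move: v0; rewrite mul_col_mx => /eqP; rewrite col_mx_eq0.
  move=> /andP[/eqP Av /eqP bv].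
  apply: zw => [i zi|].
    by have := AE v^T i; rewrite Av mxE zi dotvC => <-.
  by rewrite dotvC /dotv bv mxE.
have Az : A *m z = 0.
  apply/colP => i; rewrite AE mxE; case: ifP => //.
  by rewrite inE dotvC => /eqP.
have rankA : \rank A = d.
  apply/eqP; rewrite eqn_leq; apply/andP; split; last first.
    rewrite -(leq_add2r 1) -{1}rank_full -addsmxE.
    by rewrite (leq_trans (mxrank_adds_leqif _ _)) // leq_add2l rank_leq_row.
  rewrite -ltnS -[d.+1]addn1 ltn_neqAle rank_leq_col andbT.
  apply/negP => /row_fullP [B BA].
  have : z = 0 by rewrite -[z]mul1mx -BA -mulmxA Az mulmx0.
  by move=> z0; move/eqP: zb; rewrite z0 dotv0l eq_sym oner_eq0.
have [f freef eqf] := row_free_rowsub rankA.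
pose M : 'M[R]_(d + 1) := col_mx (rowsub f A) b^T.
have Munit : M \in unitmx.
  suff rankM : \rank M = \rank (col_mx A b^T).
    by rewrite -row_full_unit /row_full rankM rank_full.
  by rewrite /M -!addsmxE (adds_eqmx eqf (eqmx_refl _)).
pose W i := col (lshift 1 i) (invmx M).
(* A free family contains no zero row, so [f] selects only genuine zeros. *)
have fz i : f i \in zero_set a z.
  apply: contraT => fi; move/row_freePn: (negbT (negbF freef)); case.
  exists i; suff -> : row i (rowsub f A) = 0 by exact: sub0mx.
  by apply/rowP => k; rewrite !mxE (negPf fi).
have MW i : M *m W i = col (lshift 1 i) 1%:M by rewrite /W !colE mulmxA mulmxV.
have rowsubE v k : (rowsub f A *m v) k 0 = dotv v (a (f k)).
  by rewrite mul_rowsub_mx mxE AE fz dotvC.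
exists f, W; split => // [i k|i|o Wo].
- have := congr1 (fun v : 'cV_(d + 1) => v (lshift 1 k) 0) (MW i).
  rewrite mul_col_mx col_mxEu rowsubE => ->.
  by rewrite !mxE (inj_eq (@lshift_inj _ _)) eq_sym.
- have := congr1 (fun v : 'cV_(d + 1) => v (rshift d ord0) 0) (MW i).
  by rewrite mul_col_mx col_mxEd dotvC /dotv => ->; rewrite !mxE eq_rlshift.
(* The row [r] holds the coordinates of [o] in the basis of rows of [M]; all but the one along [b]
   are the values [dotv (W i) o]. *)
- pose r := o^T *m invmx M; exists (r 0 (rshift d ord0)).
  have r0 : lsubmx r = 0.
    apply/rowP => i; rewrite !mxE -[RHS](Wo i) dotvC /dotv [RHS]mxE.
    by apply: eq_bigr => k _; rewrite [col _ _ _ _]mxE.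
  apply: (can_inj (@trmxK _ _ _)).
  rewrite -[LHS](mulmxKV Munit) -/r -[in LHS](hsubmxK r) mul_row_col r0.
  by rewrite mul0mx add0r [rsubmx r]mx11_scalar mul_scalar_mx linearZ /= mxE.
Qed.

(** * Quantiles and depth regions *)

Section Quantiles.
Variables (R : realType) (d n : nat) (X : 'I_n -> 'cV[R]_d) (tau : R).
Implicit Types u x : 'cV[R]_d.

Definition le_count u (t : R) : nat := #|[pred i | dotv u (X i) <= t]|.
Definition lt_count u (t : R) : nat := #|[pred i | dotv u (X i) < t]|.

Lemma sample_countE (A : set 'cV[R]_d) (p : pred 'I_n) :
  (forall i, A (X i) <-> p i) -> sample_count X A = #|p|.
Proof.
move=> Ap; apply: eq_card => i; rewrite [LHS]inE -[RHS]/(p i).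
by apply/idP/idP => [/set_mem /Ap|/Ap /mem_set].
Qed.

Lemma empirical_leE u (t : R) :
  empirical X [set y | dotv u y <= t] = (le_count u t)%:R / n%:R.
Proof.
by rewrite /empirical (sample_countE (p := [pred i | dotv u (X i) <= t])).
Qed.

Lemma sample_count_ltE u (t : R) :
  sample_count X (~` [set x | dotv u x >= t]) = lt_count u t.
Proof.
by apply: sample_countE => i; rewrite /setC /= ltNge; split=> /negP.
Qed.

Lemma le_lt_count u (s t : R) : s < t -> (le_count u s <= lt_count u t)%N.
Proof.
move=> st; apply/subset_leq_card/fintype.subsetP => i; rewrite !inE.
by move=> /le_lt_trans; apply.
Qed.

Lemma le_le_count u (s t : R) : s <= t -> (le_count u s <= le_count u t)%N.
Proof.
move=> st; apply/subset_leq_card/fintype.subsetP => i; rewrite !inE.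
by move=> /le_trans; apply.
Qed.

Lemma le_countZ (c : R) u (t : R) : 0 < c ->
  le_count (c *: u) (c * t) = le_count u t.
Proof. by move=> c0; apply: eq_card => i; rewrite !inE dotvZl ler_pM2l. Qed.

Hypothesis n_gt0 : (0 < n)%N.
Hypothesis tau_gt0 : 0 < tau.

Lemma le_empirical (m : nat) : (tau <= m%:R / n%:R) = (n%:R * tau <= m%:R).
Proof. by rewrite ler_pdivlMr ?ltr0n // mulrC. Qed.

(** The witness is the sample point of largest projection satisfying [p]. This reduces thresholds on
    the real line to sample projections. *)
Lemma count_attained u (p : pred R) : (forall s t, s <= t -> p t -> p s) ->
    (0 < #|[pred i | p (dotv u (X i))]|)%N ->
  exists2 i, p (dotv u (X i)) &
    le_count u (dotv u (X i)) = #|[pred i | p (dotv u (X i))]|.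
Proof.
move=> p_down /card_gt0P [i0 pi0].
case: (arg_maxP (fun i => dotv u (X i)) pi0) => i pi maxi; exists i => //.
apply: eq_card => k; rewrite !inE; apply/idP/idP => [ki|pk].
  exact: p_down ki pi.
exact: maxi.
Qed.

Hypothesis tau_le1 : tau <= 1.

(** The admissible thresholds form a closed ray starting at the least admissible sample projection,
    so the infimum is attained. *)
Lemma quantile_le u (t : R) :
  (quantile X tau u <= t) = (n%:R * tau <= (le_count u t)%:R).
Proof.
pose ok s := n%:R * tau <= (le_count u s)%:R.
have ntau_gt0 : 0 < n%:R * tau by rewrite mulr_gt0 ?ltr0n.
have ok_attained s : ok s -> exists2 i, dotv u (X i) <= s & ok (dotv u (X i)).
  move=> oks; have [||i iu eqi] := @count_attained u (fun r => r <= s).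
      by move=> ? ? /le_trans; apply.
    by rewrite -(ltr0n R); apply: lt_le_trans oks.
  by exists i; rewrite // /ok eqi.
(* The largest projection counts all [n] points, which is enough because [tau <= 1]. *)
have [i0 ok0] : exists i0, ok (dotv u (X i0)).
  pose i1 := Ordinal n_gt0.
  case: (@arg_maxP _ _ _ i1 xpredT (fun i => dotv u (X i))) => // i _ maxi.
  exists i; rewrite /ok; have -> : le_count u (dotv u (X i)) = n.
    rewrite -[RHS]card_ord;  apply: eq_card => k; rewrite !inE; exact: maxi.
  by rewrite ler_piMr.
pose val i := dotv u (X i).
case: (@arg_minP _ _ _ i0 (ok \o val) val ok0) => i oki mini.
have okE s : ok s = (dotv u (X i) <= s).
  apply/idP/idP => [/ok_attained [k ks okk]|i_le].
    by apply: le_trans ks; exact: mini.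
  by apply: le_trans oki _; rewrite ler_nat le_le_count.
have -> : quantile X tau u = dotv u (X i).
  have setE s : tau <= proj_cdf X u s <-> dotv u (X i) <= s.
    by rewrite /proj_cdf empirical_leE le_empirical -okE.
  apply/eqP; rewrite eq_le; apply/andP; split.
    apply: ge_inf; last exact/setE.
    by exists (dotv u (X i)) => s /setE.
  by apply: lb_le_inf; [exists (dotv u (X i)); exact/setE|move=> s /setE].
exact/esym/okE.
Qed.

(** Otherwise the largest projection below the quantile would already be an admissible threshold. *)
Lemma lt_count_quantile u : (lt_count u (quantile X tau u))%:R < n%:R * tau.
Proof.
rewrite ltNge; apply/negP => okq.
have [||i iq eqi] := @count_attained u (fun r => r < quantile X tau u).
  by move=> ? ? /le_lt_trans; apply.
  by rewrite -(ltr0n R); apply: lt_le_trans okq; rewrite mulr_gt0 ?ltr0n.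
by move: iq; rewrite ltNge quantile_le eqi okq.
Qed.

Lemma le_quantile u (t : R) :
  (lt_count u t)%:R < n%:R * tau -> t <= quantile X tau u.
Proof.
apply: contraTT; rewrite -ltNge -leNgt => /le_lt_count qt.
have := lexx (quantile X tau u); rewrite quantile_le => /le_trans -> //.
by rewrite ler_nat; apply: qt.
Qed.

End Quantiles.

Section DepthRegion.
Variables (R : realType) (d n : nat) (X : 'I_n -> 'cV[R]_d) (tau : R).
Hypotheses (d_gt0 : (0 < d)%N) (n_gt0 : (0 < n)%N).
Implicit Types u x : 'cV[R]_d.

Lemma usphere_nonempty : exists u : 'cV[R]_d, usphere u.
Proof.
exists (delta_mx (Ordinal d_gt0) 0); apply/usphereE.
rewrite dotvE (bigD1 (Ordinal d_gt0)) //= !mxE !eqxx mulr1 big1 ?addr0 // => i.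
by rewrite !mxE => /negPf ->; rewrite mul0r.
Qed.

Lemma depth_regionP x : depth_region X tau x <->
  forall u, usphere u -> n%:R * tau <= (le_count X u (dotv u x))%:R.
Proof.
rewrite /depth_region /= /depth; split=> [taux u u1|taux].
  rewrite -le_empirical // -empirical_leE; apply: le_trans taux _.
  apply: ge_inf; last by exists u.
  by exists 0 => _ [v _ <-]; rewrite divr_ge0.
apply: lb_le_inf; last first.
  by move=> _ [u u1 <-]; rewrite empirical_leE le_empirical // taux.
by have [u u1] := usphere_nonempty; eexists; exists u.
Qed.

(* The depths are infima of multiples of 1/n, so those below tau are bounded
   away from tau. *)
Lemma depth_region_nonempty : tau <= sup (range (depth X)) ->
  exists y, depth_region X tau y.
Proof.
move=> tau_sup; apply: contrapT => none.
move: tau_sup; apply/negP; rewrite -ltNge.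
pose lam : R := (Num.ceil (n%:R * tau) - 1)%:~R / n%:R.
have lam_tau : lam < tau by rewrite ltr_pdivrMr ?ltr0n // mulrC ceilB1_lt.
apply: le_lt_trans lam_tau; apply: ge_sup; first by exists (depth X 0), 0.
move=> _ [y _ <-].
have {none} : ~ depth_region X tau y by move=> ?; apply: none; exists y.
rewrite /depth_region /= => /negP; rewrite -ltNge => /inf_lt [].
  by have [u u1] := usphere_nonempty; eexists; exists u.
move=> _ [u u1 <-] lt_tau.
apply: (@le_trans _ _ (empirical X [set z | dotv u z <= dotv u y])).
  apply: ge_inf; last by exists u.
  by exists 0 => _ [v _ <-]; rewrite divr_ge0.
move: lt_tau; rewrite empirical_leE ltNge le_empirical // -ltNge => lt_tau.
rewrite ler_pM2r ?invr_gt0 ?ltr0n // -[X in X <= _]/((Posz _)%:~R) ler_int.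
by rewrite lerBrDr -ltzD1 ltrD2r ceil_gt_int.
Qed.

Lemma depth_region_halfspace x : 0 < tau -> tau <= 1 ->
  depth_region X tau x <-> forall u, usphere u -> halfspace X tau u x.
Proof.
move=> tau0 tau1; rewrite depth_regionP /halfspace /=.
by split=> H u u1; have := H u u1; rewrite quantile_le.
Qed.

Lemma depth_region_tau_le1 x : depth_region X tau x -> tau <= 1.
Proof.
have [u u1] := usphere_nonempty; move=> /depth_regionP /(_ u u1) /le_trans le_n.
have /le_n : (le_count X u (dotv u x))%:R <= n%:R :> R.
  by rewrite ler_nat -[leqRHS]card_ord max_card.
by rewrite ger_pMr ?ltr0n.
Qed.

End DepthRegion.

(** * Affine geometry and small rotations *)

Section AffineGeometry.
Variables (R : realType) (d : nat).
Implicit Types u v x y : 'cV[R]_d.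

Lemma dotv_span0 u (s : seq 'cV[R]_d) :
    (forall v, v \in s -> dotv u v = 0) ->
  forall v, v \in <<s>>%VS -> dotv u v = 0.
Proof.
move=> us v; rewrite -[s]/(tval (in_tuple s)) => /coord_span ->.
rewrite dotv_sumr big1 // => i _.
by rewrite dotvZr us ?mulr0 // mem_nth.
Qed.

(** Removing from [v] its projection on [u] leaves a vector orthogonal to both [U] and [u], which
    together span the space; it is therefore orthogonal to itself. *)
Lemma orthogonal_line (U : {vspace 'cV[R]_d}) u v : (\dim U).+1 = d -> u != 0 ->
    (forall y, y \in U -> dotv u y = 0) ->
    (forall y, y \in U -> dotv v y = 0) ->
  v = (dotv v u / dotv u u) *: u.
Proof.
move=> dimU u0 uU vU.
have uu0 : dotv u u != 0 by rewrite dotv_eq0.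
have full : (U + <[u]>)%VS = fullv.
  apply/eqP; rewrite eqEdim subvf dimvf dim_matrix [(_ * _)%R]muln1 -{1}dimU.
  rewrite ltn_neqAle dimvS ?addvSl // andbT; apply/eqP => dimE.
  have : U == (U + <[u]>)%VS by rewrite eqEdim addvSl -dimE leqnn.
  move=> /eqP UE; have : u \in U by rewrite UE (subvP (addvSr _ _)) ?memv_line.
  by move=> /uU /eqP; apply/negP.
apply/eqP; rewrite -subr_eq0 -dotv_eq0; set w := v - _.
have : w \in (U + <[u]>)%VS by rewrite full memvf.
move=> /memv_addP [y yU [_ /vlineP [c ->] wE]].
rewrite {2}wE dotvDr dotvZr /w !dotvBl !dotvZl (uU _ yU) (vU _ yU) divfK //.
by rewrite subrr mulr0 mulr0 subrr addr0.
Qed.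

Lemma affine_hull_pt (m : nat) (p : 'I_m -> 'cV[R]_d) i : affine_hull p (p i).
Proof.
exists (fun k => (k == i)%:R); split.
  by rewrite (bigD1 i) //= eqxx big1 ?addr0 // => k /negPf ->.
rewrite (bigD1 i) //= eqxx scale1r big1 ?addr0 // => k /negPf ->.
by rewrite scale0r.
Qed.

Lemma dotv_affine_hull (m : nat) (p : 'I_m -> 'cV[R]_d) u (c : R) :
  (forall i, dotv u (p i) = c) -> forall x, affine_hull p x -> dotv u x = c.
Proof.
move=> up x [e [e1 ->]]; rewrite dotv_sumr.
by under eq_bigr do rewrite dotvZr up; rewrite -mulr_suml e1 mul1r.
Qed.

(** On differences of points the constants [e i] cancel, so the [w i] with [i] nonzero are dual to
    the differences from [p ord0], which are therefore free. *)
Lemma affine_dim_dual (m : nat) (p w : 'I_m.+1 -> 'cV[R]_d) (e : 'I_m.+1 -> R) :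
  (forall i k, dotv (w i) (p k) - e i = (i == k)%:R) -> affine_dim p = m.
Proof.
move=> wp; pose q := [tuple p (lift ord0 i) - p ord0 | i < m].
have qE (i : 'I_m) : q`_i = p (lift ord0 i) - p ord0.
  by rewrite -tnth_nth tnth_mktuple.
have spanE : <<[seq p i - p j | i <- enum 'I_m.+1, j <- enum 'I_m.+1]>>%VS
           = <<q>>%VS.
  have qspan i : p i - p ord0 \in <<q>>%VS.
    have [k ->|->] := unliftP ord0 i; last by rewrite subrr mem0v.
    by rewrite memv_span // -qE mem_nth // size_tuple.
  apply/eqP; rewrite eqEsubv; apply/andP; split; apply/span_subvP => v.
    move=> /allpairsP [[i j] /= [_ _ ->]].
    by rewrite -(subrKA (p ord0)) -[p ord0 - _]opprB rpredB.
  move=> /(nthP 0) [i]; rewrite size_tuple => im <-.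
  rewrite (qE (Ordinal im)) memv_span //; apply/allpairsP.
  by exists (lift ord0 (Ordinal im), ord0); rewrite !mem_enum.
rewrite /affine_dim spanE; suff /eqP -> : free q by rewrite size_tuple.
apply/freeP => c c0 i; have := congr1 (dotv (w (lift ord0 i))) c0.
have wdiff k : dotv (w (lift ord0 i)) (p (lift ord0 k) - p ord0) = (i == k)%:R.
  have -> : dotv (w (lift ord0 i)) (p (lift ord0 k) - p ord0)
      = (lift ord0 i == lift ord0 k)%:R - (lift ord0 i == ord0)%:R.
    by rewrite dotvBr -!wp; ring.
  by rewrite (inj_eq lift_inj) [_ == ord0]eq_sym (negPf (neq_lift _ _)) subr0.
rewrite dotv0r dotv_sumr (bigD1 i) //= dotvZr qE wdiff eqxx mulr1.
rewrite big1 ?addr0 // => k /negPf ki.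
by rewrite dotvZr qE wdiff eq_sym ki mulr0.
Qed.

Lemma positive_near u (n : nat) (y : 'I_n -> 'cV[R]_d) :
  exists2 delta : R, 0 < delta &
    forall u', enorm (u' - u) < delta ->
      forall i, 0 < dotv u (y i) -> 0 < dotv u' (y i).
Proof.
pose l1 i : R := 1 + \sum_k `|y i k 0|.
have l1_gt0 i : 0 < l1 i by rewrite ltr_wpDr // sumr_ge0.
(* The default 1 keeps the radius positive when no [y i] qualifies; the summand 1 in [l1] keeps the
   denominators positive. *)
exists (\big[Num.min/1]_(i | 0 < dotv u (y i)) (dotv u (y i) / l1 i)).
  by apply: lt_bigmin => // i uy; rewrite divr_gt0.
move=> u' u'u i uy.
have {}u'u := lt_le_trans u'u
  (bigmin_le_cond 1 (fun i => dotv u (y i) / l1 i) uy).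
have uu'_lt : `|dotv (u' - u) (y i)| < dotv u (y i).
  apply: le_lt_trans (dotv_norm_le _ _) _.
  apply: (@le_lt_trans _ _ (enorm (u' - u) * l1 i)).
    by rewrite ler_wpM2l ?sqrtr_ge0 // lerDr.
  by rewrite -ltr_pdivlMr.
by move: uu'_lt; rewrite dotvBl ltr_norml => /andP[]; lra.
Qed.

(** With [r] the norm of [u + t *: w], the squared distance is [2 - 2 / r] and the squared bound is
    [r ^+ 2 - 1]; their difference times [r] is [(r - 1) ^+ 2 * (r + 2)]. *)
Lemma enorm_orthogonal_step u w (t : R) : dotv u u = 1 -> dotv u w = 0 -> 0 < t ->
  enorm ((enorm (u + t *: w))^-1 *: (u + t *: w) - u) <= t * enorm w.
Proof.
move=> u1 uw t0; set v := u + t *: w; set r := enorm v.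
have vv : dotv v v = 1 + t ^+ 2 * dotv w w.
  by rewrite /v !(dotvDl, dotvDr, dotvZl, dotvZr) u1 [dotv w u]dotvC uw; ring.
have r2 : r ^+ 2 = dotv v v by rewrite sqr_sqrtr ?dotv_ge0.
have r_ge1 : 1 <= r.
  rewrite -(ler_pXn2r (n := 2)) ?nnegrE ?sqrtr_ge0 // expr1n r2 vv lerDl.
  by rewrite mulr_ge0 ?sqr_ge0 ?dotv_ge0.
have r0 : r != 0 by rewrite gt_eqF // (lt_le_trans ltr01).
rewrite -[t * _]ger0_norm ?mulr_ge0 ?sqrtr_ge0 ?(ltW t0) // -sqrtr_sqr.
rewrite [leLHS]/enorm ler_wsqrtr // exprMn sqr_sqrtr ?dotv_ge0 //.
have -> : dotv (r^-1 *: v - u) (r^-1 *: v - u) = 2 - 2 / r.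
  rewrite !(dotvBl, dotvBr, dotvZl, dotvZr) -r2 u1 [dotv u v]dotvC.
  have -> : dotv v u = 1.
    by rewrite /v dotvDl dotvZl u1 [dotv w u]dotvC uw mulr0 addr0.
  by field.
have -> : t ^+ 2 * dotv w w = r ^+ 2 - 1 by rewrite r2 vv; lra.
have -> : 2 - 2 / r = 2 * (r - 1) / r by field.
rewrite ler_pdivrMr; last by lra.
rewrite -subr_ge0.
have -> : (r ^+ 2 - 1) * r - 2 * (r - 1) = (r - 1) ^+ 2 * (r + 2) by ring.
by rewrite mulr_ge0 ?sqr_ge0 //; lra.
Qed.

End AffineGeometry.

(** This and the next lemma turn the integer bounds of [irrotatable] into comparisons of counts with
    [n%:R * tau]. *)
Lemma le_ceilB1 (R : realType) (m : nat) (x : R) :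
  (m%:Z <= Num.ceil x - 1) = (m%:R < x).
Proof. by rewrite lerBrDr -ltzD1 ltrD2r ceil_gt_int. Qed.

Lemma ceilB1_lt_nat (R : realType) (m : nat) (x : R) :
  (Num.ceil x - 1 < m%:Z) = (x <= m%:R).
Proof. by rewrite ltNge le_ceilB1 -leNgt. Qed.

(** * Affine hyperplanes as vectors with one more coordinate *)

Section Hyperplanes.
Variables (R : realType) (d : nat).
Implicit Types u x : 'cV[R]_d.

(* The vector (u, c) stands for the affine form u^T x - c. *)
Definition hyperplane u (c : R) : 'cV[R]_(d + 1) := col_mx u (const_mx c).
Definition homog x : 'cV[R]_(d + 1) := col_mx x (const_mx (-1)).

Lemma dotv_hyperplane u (c : R) x :
  dotv (hyperplane u c) (homog x) = dotv u x - c.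
Proof.
rewrite /dotv tr_col_mx mul_row_col mxE; congr (_ + _).
by rewrite mxE big_ord1 !mxE mulrN1.
Qed.

Lemma hyperplaneP z : exists u c, z = hyperplane u c.
Proof.
exists (usubmx z), (dsubmx z 0 0); rewrite /hyperplane -[LHS]vsubmxK.
by congr col_mx; apply/colP => i; rewrite !mxE (ord1 i).
Qed.

Lemma hyperplaneD u v (c e : R) :
  hyperplane u c + hyperplane v e = hyperplane (u + v) (c + e).
Proof.
by rewrite /hyperplane add_col_mx; congr col_mx; apply/colP => i; rewrite !mxE.
Qed.

Lemma hyperplaneZ (t : R) u (c : R) :
  t *: hyperplane u c = hyperplane (t *: u) (t * c).
Proof.
rewrite /hyperplane scale_col_mx; congr col_mx.
by apply/colP => i; rewrite !mxE.
Qed.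

(** The last coordinates are 1 and 0. Hence the objective used below is no multiple of the
    normalising vector. *)
Lemma homog_neq x y (t : R) : - homog x <> t *: (homog y - homog x).
Proof.
move=> /(congr1 dsubmx)/matrixP/(_ 0 0)/eqP.
rewrite linearN linearZ linearB /= !col_mxKd !mxE opprK addNr mulr0.
by rewrite oner_eq0.
Qed.

Variables (n : nat) (X : 'I_n -> 'cV[R]_d).

Lemma card_neg_set u (c : R) :
  #|neg_set (homog \o X) (hyperplane u c)| = lt_count X u c.
Proof. by apply: eq_card => i; rewrite !inE dotv_hyperplane subr_lt0. Qed.

Lemma mem_zero_set u (c : R) i :
  (i \in zero_set (homog \o X) (hyperplane u c)) = (dotv u (X i) == c).
Proof. by rewrite inE dotv_hyperplane subr_eq0. Qed.

Hypothesis hullX : affine_hull X = [set: 'cV[R]_d].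

Lemma not_in_hyperplane u (c : R) :
  (forall i, dotv u (X i) = c) -> u = 0 /\ c = 0.
Proof.
move=> uX; have uc x : dotv u x = c.
  by apply: (dotv_affine_hull uX); rewrite hullX.
have c0 : c = 0 by rewrite -(uc 0) dotv0r.
by split=> //; apply/eqP; rewrite -dotv_eq0 uc c0.
Qed.

Lemma homog_span z : (forall i, dotv z (homog (X i)) = 0) -> z = 0.
Proof.
have [u [c ->]] := hyperplaneP z => uX.
have [i|-> ->] := @not_in_hyperplane u c.
  by apply/eqP; rewrite -subr_eq0 -dotv_hyperplane uX.
by rewrite /hyperplane -col_mx0; congr col_mx; apply/colP => i; rewrite !mxE.
Qed.

End Hyperplanes.

(** * Irrotatable halfspaces *)

Section Finiteness.
Variables (R : realType) (m n : nat) (X : 'I_n -> 'cV[R]_m.+2) (tau : R).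
Implicit Types u v : 'cV[R]_m.+2.

Definition boundary_set u : {set 'I_n} :=
  [set i | dotv u (X i) == quantile X tau u].
Definition cut_set u : {set 'I_n} :=
  [set i | dotv u (X i) < quantile X tau u].

(* Some boundary point lies off V: otherwise small rotations around V cut away
   no new sample point. *)
Lemma irrotatable_facet u : irrotatable X tau u ->
  exists2 U : {vspace 'cV[R]_m.+2}, \dim U = m.+1 &
    forall v, {in boundary_set u &, forall i k, dotv v (X i) = dotv v (X k)} ->
      forall y, y \in U -> dotv v y = 0.
Proof.
rewrite /irrotatable /=; move=> [u1 cut _ [s [sbd dims rot]]].
pose p := X \o s; pose p0 := p ord0.
pose D := <<[seq p i - p j | i <- enum 'I_m.+1, j <- enum 'I_m.+1]>>%VS.
have dimD : \dim D = m by [].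
have perpD v c : (forall i, dotv v (p i) = c) ->
    forall y, y \in D -> dotv v y = 0.
  move=> vp; apply: dotv_span0 => y /allpairsP [[i j] /= [_ _ ->]].
  by rewrite dotvBr !vp subrr.
have [i ibd iD] : exists2 i, i \in boundary_set u & X i - p0 \notin D.
  apply: contrapT => noi.
  have [delta delta0 near_u] := positive_near u (fun i => X i - p0).
  have [u' [c [_ uu' u'c]]] := rot _ delta0; apply/negP; rewrite -leNgt.
  have {}u'c k : dotv u' (p k) = c by apply: u'c; exact: affine_hull_pt.
  apply: le_trans cut; rewrite lez_nat !sample_count_ltE.
  apply/subset_leq_card/fintype.subsetP => i; rewrite !inE => u'i.
  (* A point cut by [u'] but not by [u] is impossible: on the old boundary it lies in V, where [u']
     is constant; strictly inside, it stays inside for [u'] near [u]. *)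
  rewrite ltNge le_eqVlt; apply/negP => /orP [/eqP uq|uq].
    have iD : X i - p0 \in D.
      by apply: contrapT => /negP iD; apply: noi; exists i; rewrite // inE uq.
    by have := perpD _ _ u'c _ iD; rewrite dotvBr u'c; lra.
  have := near_u _ uu' i; rewrite !dotvBr u'c.
  by have := sbd ord0; rewrite /halfspace_bd /= => -> /(_ ltac:(lra)); lra.
exists (D + <[X i - p0]>)%VS.
  apply/eqP; rewrite eqn_leq; apply/andP; split.
    apply: leq_trans (dimv_add_leqif _ _) _.
    by rewrite dimD dim_vline addnC; case: (_ != _).
  have : (\dim D <= \dim (D + <[(X i - p0)%R]>))%N by rewrite dimvS ?addvSl.
  rewrite dimD leq_eqVlt => /orP [/eqP dimE|//].
  exfalso; move/negP: iD; apply.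
  have /eqP -> : D == (D + <[(X i - p0)%R]>)%VS.
    by rewrite eqEdim addvSl dimD -dimE leqnn.
  by rewrite (subvP (addvSr _ _)) ?memv_line.
move=> v vbd y /memv_addP [y1 y1D [_ /vlineP [c ->] ->]].
have sbd' k : s k \in boundary_set u by rewrite inE; apply/eqP/sbd.
rewrite dotvDr dotvZr dotvBr (vbd _ _ ibd (sbd' ord0)) subrr mulr0 addr0.
by apply: (perpD v (dotv v p0)) y1D => k; apply: vbd.
Qed.

Hypothesis hullX : affine_hull X = [set: 'cV[R]_m.+2].

(** The boundary points fix the unit normal up to sign, and a sample point off the boundary, being
    cut or not, fixes the sign. Only finitely many such pairs of index sets exist. *)
Lemma irrotatable_inj u v : irrotatable X tau u -> irrotatable X tau v ->
  boundary_set u = boundary_set v -> cut_set u = cut_set v -> u = v.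
Proof.
move=> iu iv eq_bd eq_cut.
have [U dimU perpU] := irrotatable_facet iu.
have [u1 v1] : dotv u u = 1 /\ dotv v v = 1.
  by split; apply/usphereE; [case: iu|case: iv].
have u0 : u != 0 by rewrite -dotv_eq0 u1 oner_neq0.
have uU y : y \in U -> dotv u y = 0.
  by apply: perpU => i k; rewrite !inE => /eqP -> /eqP ->.
have vU y : y \in U -> dotv v y = 0.
  by apply: perpU; rewrite eq_bd => i k; rewrite !inE => /eqP -> /eqP ->.
have := orthogonal_line (congr1 S dimU) u0 uU vU; set lam := _ / _ => vE.
have lam2 : lam ^+ 2 = 1 by rewrite -v1 vE dotvZl dotvZr u1 mulr1 expr2.
have [i0 i0bd] : exists i, i \in boundary_set u.
  by case: iu => _ _ _ [s [sbd _ _]]; exists (s ord0); rewrite inE; apply/eqP/sbd.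
have [i ibd] : exists i, i \notin boundary_set u.
  apply: contrapT => none; move/eqP: u0; apply.
  apply: (proj1 (@not_in_hyperplane _ _ _ _ hullX u (quantile X tau u) _)) => i.
  by apply/eqP; apply: contrapT => /negP ni; apply: none; exists i; rewrite inE.
have qu : quantile X tau u = dotv u (X i0) by move: i0bd; rewrite inE => /eqP.
have qv : quantile X tau v = lam * dotv u (X i0).
  by move: i0bd; rewrite eq_bd inE => /eqP <-; rewrite vE dotvZl.
have u_i : dotv u (X i) - dotv u (X i0) != 0.
  by move: ibd; rewrite inE qu subr_eq0.
move: lam2 => /eqP; rewrite -[1](expr1n _ 2) eqf_sqr.
case/orP => /eqP lamE; first by rewrite vE lamE scale1r.
have : (i \in cut_set u) = (i \in cut_set v) by rewrite eq_cut.
rewrite !inE qv qu [in dotv v _]vE dotvZl lamE !mulN1r ltrN2.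
by move: u_i; rewrite subr_eq0; case: ltgtP.
Qed.

End Finiteness.

(** * Separating a shallow point by an irrotatable halfspace *)

Section Separation.
Variables (R : realType) (m n : nat) (X : 'I_n -> 'cV[R]_m.+2) (tau : R).
Hypothesis hullX : affine_hull X = [set: 'cV[R]_m.+2].
Hypotheses (n_gt0 : (0 < n)%N) (tau_gt0 : 0 < tau) (tau_le1 : tau <= 1).
Variables x0 y0 : 'cV[R]_m.+2.
Hypothesis y0_deep : depth_region X tau y0.
Hypothesis x0_shallow : ~ depth_region X tau x0.

Let a := @homog R m.+2 \o X.
Let feasible (A : {set 'I_n}) : bool := (#|A|)%:R < n%:R * tau.
Let b := homog y0 - homog x0.
Let o := - homog x0.

Lemma feasible_down (A B : {set 'I_n}) : A \subset B -> feasible B -> feasible A.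
Proof. by move=> /subset_leq_card AB; apply: le_lt_trans; rewrite ler_nat. Qed.

Lemma feasibleE u c :
  feasible (neg_set a (hyperplane u c)) = ((lt_count X u c)%:R < n%:R * tau).
Proof. by rewrite /feasible card_neg_set. Qed.

Lemma dotv_b u c : dotv (hyperplane u c) b = dotv u y0 - dotv u x0.
Proof. by rewrite dotvBr !dotv_hyperplane; ring. Qed.

Lemma dotv_o u c : dotv (hyperplane u c) o = c - dotv u x0.
Proof. by rewrite dotvNr dotv_hyperplane opprB. Qed.

(** If [c] exceeded [dotv u y0], the hyperplane would cut away all points counted by the depth of
    [y0] in direction [u], at least [n%:R * tau] of them. *)
Lemma feasible_le z : feasible (neg_set a z) -> dotv z b = 1 -> dotv z o <= 1.
Proof.
have [u [c ->]] := hyperplaneP z; rewrite feasibleE dotv_b dotv_o => fuc ub.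
suff : c <= dotv u y0 by lra.
have u0 : u != 0.
  apply/eqP => u0; move: ub; rewrite u0 !dotv0l subrr => /esym/eqP.
  by rewrite oner_eq0.
rewrite leNgt; apply/negP => /le_lt_count y0c.
move: fuc; apply/negP; rewrite -leNgt.
apply: (@le_trans _ _ (le_count X u (dotv u y0))%:R); last by rewrite ler_nat y0c.
have r_gt0 : 0 < (enorm u)^-1 by rewrite invr_gt0 enorm_gt0.
rewrite -(le_countZ X _ _ r_gt0) -dotvZl.
by have /depth_regionP := y0_deep; apply => //; exact: usphere_normalize.
Qed.

(** Some quantile halfspace excludes [x0] but contains the deep point [y0]; rescaling its hyperplane
    meets the normalisation. *)
Lemma feasible_start : exists z,
  [/\ feasible (neg_set a z), dotv z b = 1 & 0 < dotv z o].
Proof.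
have [u u1 uq] : exists2 u, usphere u & dotv u x0 < quantile X tau u.
  apply: contrapT => none; apply: x0_shallow.
  apply/depth_region_halfspace => // u u1; rewrite /halfspace /= leNgt.
  by apply/negP => uq; apply: none; exists u.
have y0q : quantile X tau u <= dotv u y0.
  by have /depth_region_halfspace := y0_deep; exact.
pose t := (dotv u y0 - dotv u x0)^-1.
have t_gt0 : 0 < t by rewrite invr_gt0; lra.
exists (t *: hyperplane u (quantile X tau u)); split.
- by rewrite neg_setZ // feasibleE lt_count_quantile.
- by rewrite dotvZl dotv_b mulVf //; lra.
- by rewrite dotvZl dotv_o mulr_gt0 // subr_gt0.
Qed.

(* Rotating around V, the direction of rotation may be taken orthogonal to u
   (subtract a multiple of the hyperplane itself), so that a step t along it,
   followed by normalisation, moves u by at most t times its norm. *)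
Lemma irrotatable_of_direction u c w (s : 'I_m.+1 -> 'I_n) :
    usphere u -> c = quantile X tau u ->
    (m.+2 <= #|boundary_set X tau u|)%N ->
    affine_dim (X \o s) = m ->
    (forall k, dotv (hyperplane u c) (a (s k)) = 0) ->
    (forall k, dotv w (a (s k)) = 0) ->
    (forall t e : R, 0 < t -> `|e| < 1 ->
       ~~ feasible (neg_set a ((1 + e) *: hyperplane u c + t *: w))) ->
  irrotatable X tau u.
Proof.
move=> u1 cq bd dims us ws infeas.
have uu : dotv u u = 1 by apply/usphereE.
rewrite /irrotatable /=; split => //.
- by rewrite sample_count_ltE le_ceilB1 lt_count_quantile.
- rewrite (@sample_countE _ _ _ _ _ [pred i | i \in boundary_set X tau u]) //.
  by move=> i; rewrite /= inE /halfspace_bd /=; split=> [->|/eqP].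
exists s; split => //.
  move=> j; rewrite /halfspace_bd /= -cq.
  by apply/eqP; rewrite -subr_eq0 -dotv_hyperplane; apply/eqP; exact: us.
move=> delta delta0.
have [wu [we wE]] := hyperplaneP w.
pose lam := dotv u wu; pose v := wu - lam *: u.
have uv : dotv u v = 0 by rewrite dotvBr dotvZr uu mulr1 subrr.
(* The step [t = M^-1] is small enough both for the factor [1 - t * lam] to satisfy the hypothesis
   and for [t * enorm v < delta]. *)
pose M := 1 + `|lam| + enorm v / delta.
have lam_ge0 : 0 <= `|lam| by [].
have v_ge0 : 0 <= enorm v / delta by rewrite divr_ge0 ?sqrtr_ge0 // ltW.
have M_gt0 : 0 < M by rewrite /M; lra.
pose t := M^-1; have t_gt0 : 0 < t by rewrite invr_gt0.
have t_lam : `|- (t * lam)| < 1.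
  by rewrite normrN normrM gtr0_norm // mulrC ltr_pdivrMr // mul1r /M; lra.
have t_v : t * enorm v < delta.
  rewrite mulrC ltr_pdivrMr // mulrC -ltr_pdivrMr // /M; lra.
pose y := (1 - t * lam) *: hyperplane u c + t *: w.
pose cy := (1 - t * lam) * c + t * we.
have yE : y = hyperplane (u + t *: v) cy.
  rewrite /y wE !hyperplaneZ hyperplaneD; congr hyperplane.
  by rewrite /v scalerBr scalerA scalerBl scale1r addrAC addrA.
have uv0 : u + t *: v != 0.
  apply/eqP => uv0; have := congr1 (dotv u) uv0.
  by rewrite dotvDr dotvZr uu uv mulr0 addr0 dotv0r => /eqP; rewrite oner_eq0.
pose r := (enorm (u + t *: v))^-1.
have r_gt0 : 0 < r by rewrite invr_gt0 enorm_gt0.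
exists (r *: (u + t *: v)), (r * cy); split.
- exact: usphere_normalize.
- by apply: le_lt_trans t_v; exact: enorm_orthogonal_step.
- apply: dotv_affine_hull => k; apply/eqP.
  rewrite -subr_eq0 -dotv_hyperplane -hyperplaneZ -yE dotvZl dotvDl !dotvZl.
  by rewrite [dotv _ _](us k) [dotv w _](ws k) !mulr0 addr0 mulr0.
- rewrite sample_count_ltE ceilB1_lt_nat leNgt -card_neg_set -hyperplaneZ -yE.
  by rewrite neg_setZ //; exact: infeas.
Qed.

Lemma irrotatable_separates :
  exists2 u, irrotatable X tau u & ~ halfspace X tau u x0.
Proof.
have [z0 [fz0 z0b z0o]] := feasible_start.
have [z [fz zb zvert] zmax] :=
  optimal_vertex feasible_down (homog_span hullX) feasible_le fz0 z0b.
have V_gt0 : 0 < dotv z o by apply: lt_le_trans z0o _; exact: zmax.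
have [f [W [fzero Wdual Wb Wspan]]] := dual_basis zb zvert.
have [j Wj] : exists j, dotv (W j) o != 0.
  apply: contrapT => none; have [|e] := Wspan o; last exact: homog_neq.
  by move=> i; apply/eqP; apply: contrapT => /negP ?; apply: none; exists i.
(* Feasibility is invariant under positive scaling, so optimality extends to hyperplanes that are
   not normalised. *)
have max_homog y : feasible (neg_set a y) -> 0 < dotv y b ->
    dotv y o <= dotv z o * dotv y b.
  move=> fy yb; rewrite -ler_pdivrMr // mulrC -dotvZl; apply: zmax.
    by rewrite neg_setZ ?invr_gt0.
  by rewrite dotvZl mulVf // gt_eqF.
(* The sign orients the rotation so that the objective increases. *)
pose w := Num.sg (dotv (W j) o) *: W j.
have wo : 0 < dotv w o by rewrite dotvZl -normrEsg normr_gt0.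
have wb : dotv w b = 0 by rewrite dotvZl Wb mulr0.
have [u [c zE]] := hyperplaneP z.
have u0 : u != 0.
  apply/eqP => u0; move: zb; rewrite zE dotv_b u0 !dotv0l subrr => /esym/eqP.
  by rewrite oner_eq0.
pose r := (enorm u)^-1; have r_gt0 : 0 < r by rewrite invr_gt0 enorm_gt0.
have rzE : r *: z = hyperplane (r *: u) (r * c) by rewrite zE hyperplaneZ.
have feas_rz : feasible (neg_set a (hyperplane (r *: u) (r * c))).
  by rewrite -rzE neg_setZ.
have rzb : dotv (r *: z) b = r by rewrite dotvZl zb mulr1.
(* Feasibility puts [r * c] at or below the quantile; the parallel hyperplane at the quantile is
   feasible too, so maximality gives equality. *)
have ru_q : r * c = quantile X tau (r *: u).
  apply/eqP; rewrite eq_le le_quantile -?feasibleE //=.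
  have := @max_homog (hyperplane (r *: u) (quantile X tau (r *: u))).
  rewrite feasibleE lt_count_quantile // => /(_ isT).
  have := rzb; have := dotvZl r z o; rewrite rzE !dotv_o !dotv_b => zo ->.
  move=> /(_ r_gt0).
  by rewrite mulrC -zo lerD2r.
exists (r *: u); last first.
  rewrite /halfspace /= -ru_q; apply/negP; rewrite -ltNge -subr_gt0.
  by rewrite -(dotv_o (r *: u) (r * c)) -rzE dotvZl mulr_gt0.
have f_inj : injective f.
  move=> i k fik; have := Wdual i k; rewrite -fik Wdual eqxx.
  by case: eqVneq => // _ /eqP; rewrite oner_eq0.
have fbd i : f i \in boundary_set X tau (r *: u).
  by rewrite inE -ru_q -mem_zero_set -rzE zero_setZ ?gt_eqF // fzero.
apply: (@irrotatable_of_direction _ (r * c) w (f \o lift j)) => //.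
- exact: usphere_normalize.
- rewrite -[X in (X <= _)%N]card_ord -(card_codom f_inj).
  by apply/subset_leq_card/fintype.subsetP => _ /codomP [i ->].
(* The dual vectors other than [W j], read as affine forms, show the remaining points affinely
   independent. *)
- have Wdual' i k : dotv (usubmx (W (lift j i))) (X (f (lift j k)))
      - dsubmx (W (lift j i)) 0 0 = (i == k)%:R.
    rewrite -(inj_eq (@lift_inj _ j)) -Wdual -dotv_hyperplane; congr dotv.
    rewrite /hyperplane -[RHS]vsubmxK; congr col_mx.
    by apply/colP => l; rewrite !mxE (ord1 l).
  exact: affine_dim_dual Wdual'.
- move=> k; rewrite -rzE dotvZl /=.
  by have := fzero (lift j k); rewrite inE => /eqP ->; rewrite mulr0.
- by move=> k; rewrite dotvZl Wdual (negPf (neq_lift _ _)) mulr0.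
(* The term [t *: w] leaves the value at [b] unchanged but adds [t * dotv w o > 0] to the objective,
   exceeding the optimum. *)
move=> t e t0 e1; apply/negP => /max_homog.
rewrite -rzE !dotvDl 2!(dotvZl (1 + e)) !(dotvZl t) rzb wb mulr0 addr0.
have e_gt0 : 0 < 1 + e by move: e1; rewrite ltr_norml => /andP[]; lra.
move=> /(_ (mulr_gt0 e_gt0 r_gt0)); rewrite dotvZl.
by have := mulr_gt0 t0 wo; nra.
Qed.

End Separation.

(** * Enumeration of the irrotatable halfspaces and conclusion *)

Theorem lemma3 (R : realType) (d n : nat) (X : 'I_n -> 'cV[R]_d) (tau : R)
    (hd : (2 <= d)%N)
    (hX : affine_hull X = [set: 'cV[R]_d])
    (htau : 0 < tau <= sup (range (depth X))) :
  exists (m : nat) (mu : 'I_m -> 'cV[R]_d),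
    [/\ forall i, irrotatable X tau (mu i),
        injective (fun i => halfspace X tau (mu i)),
        forall u, irrotatable X tau u ->
          exists i, halfspace X tau u = halfspace X tau (mu i) &
        depth_region X tau =
          \bigcap_(i in [set: 'I_m]) halfspace X tau (mu i)].
Proof.
case: d hd X hX htau => [//|[//|m]] _ X hX /andP [tau0 tau_sup].
have n0 : (0 < n)%N.
  rewrite lt0n; apply/eqP => n0; have : affine_hull X 0 by rewrite hX.
  case=> e [e1 _]; move/eqP: e1; rewrite big1 => [|i _].
    by rewrite eq_sym oner_eq0.
  by have := ltn_ord i; rewrite {2}n0.
have [y0 y0_deep] := depth_region_nonempty (ltn0Sn _) n0 tau_sup.
have tau1 := depth_region_tau_le1 (ltn0Sn _) n0 y0_deep.
have fin : finite_set (halfspace X tau @` [set u | irrotatable X tau u]).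
  apply: finite_image.
  (* Codes range over a finite type, and an irrotatable direction is recovered from its code. *)
  pose code u := (boundary_set X tau u, cut_set X tau u).
  pose of_code c := xget 0 [set u | irrotatable X tau u /\ code u = c].
  apply: (@sub_finite_set _ _ (range of_code)); last exact: finite_image.
  move=> u iu; exists (code u) => //; apply: xget_unique => // v [iv [bd cut]].
  exact: irrotatable_inj iv iu bd cut.
have [hs hsE] := (finite_seqP _).1 fin.
have memhs h : h \in hs <->
    exists2 u, irrotatable X tau u & halfspace X tau u = h.
  by split=> hh; have : [set` hs] h; rewrite -?hsE //; move: hh; rewrite hsE.
(* Removing repetitions makes the enumeration of halfspaces injective. *)
pose us := undup hs.
have mu_ex (i : 'I_(size us)) : exists u,
    irrotatable X tau u /\ halfspace X tau u = nth set0 us i.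
  have : nth set0 us i \in us by exact: mem_nth.
  by rewrite mem_undup => /memhs [u iu uE]; exists u.
have [mu muP] := choice mu_ex.
have mu_all u : irrotatable X tau u ->
    exists i, halfspace X tau u = halfspace X tau (mu i).
  move=> iu; have : halfspace X tau u \in us.
    by rewrite mem_undup; apply/memhs; exists u.
  by move=> /(nthP set0) [i i_lt <-]; exists (Ordinal i_lt); rewrite (muP _).2.
exists (size us), mu; split => //.
- by move=> i; have [] := muP i.
- move=> i k; rewrite (muP i).2 (muP k).2 => /eqP.
  by rewrite nth_uniq ?undup_uniq // => /eqP /val_inj.
- apply/seteqP; split=> x /=.
    by move=> /depth_region_halfspace xD i _; apply: xD => //; have [[]] := muP i.
  move=> xmu; apply: contrapT => x_shallow.
  have [u iu ux] := irrotatable_separates hX n0 tau0 tau1 y0_deep x_shallow.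
  by apply: ux; have [i ->] := mu_all u iu; exact: xmu.
Qed.
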